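(* Let $q=p^e$ with $p$ a prime, and suppose $q\equiv 1 \pmod 4$. Let $f,g\in\mathbb{F}_q$ with $f\neq 0$ be such that $E_2: y^2=x^3+fx^2+gx$ is an elliptic curve over $\mathbb{F}_q$. Let $T$ be a generator of the character group $\widehat{\mathbb{F}_q^{\times}}$. Then $$a_q(E_2)=-q\,T^{\frac{q-1}{2}}(2f)\,T^{\frac{q-1}{4}}(-1)\;{}_{2}F_1\left(\begin{array}{cc} T^{\frac{q-1}{4}}, & T^{\frac{3(q-1)}{4}}\\ & \epsilon\end{array}\Big|\, \frac{4g}{f^2}\right),$$ where $\epsilon$ is the trivial character.
   Context: Every multiplicative character $\chi$ of $\mathbb{F}_q^{\times}$ (including the trivial character $\epsilon$) is extended to $\mathbb{F}_q$ by $\chi(0):=0$. For characters $A,B$ of $\mathbb{F}_q^{\times}$, define ${A \choose B}:=\frac{B(-1)}{q}\sum_{x\in\mathbb{F}_q}A(x)\overline{B}(1-x)$, where $\overline{B}$ is the inverse character. Greene's Gaussian hypergeometric series is ${}_{2}F_1\left(\begin{array}{cc} A_0, & A_1\\ & B_1\end{array}\Big|\, x\right):=\frac{q}{q-1}\sum_{\chi}{A_0\chi \choose \chi}{A_1\chi \choose B_1\chi}\chi(x)$ for $x\in\mathbb{F}_q$, the sum over all characters $\chi$ of $\mathbb{F}_q^{\times}$. The trace of Frobenius is $a_q(E)=q+1-\#E(\mathbb{F}_q)$, where $\#E(\mathbb{F}_q)$ counts the $\mathbb{F}_q$-points including the point at infinity. Powers of characters are pointwise, e.g. $T^{m}(x)=T(x)^m$.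 *)

(* Defs.v *)
From HB Require Import structures.
From mathcomp Require Import all_boot all_order all_algebra all_fingroup.
From mathcomp Require Import all_solvable all_field all_character.

Set Implicit Arguments.
Unset Strict Implicit.
Unset Printing Implicit Defensive.

Import GRing.Theory Num.Theory.
Local Open Scope ring_scope.

(* A multiplicative character of F^* is a linear character of [set: {unit F}],
   i.e. a chi : 'CF([set: {unit F}]) with chi \is a linear_char.  In the ring of
   class functions the product, inverse and powers of characters are pointwise,
   and 1 is the trivial character.  Values are taken in algC, which contains
   all the roots of unity. *)
Notation char_type F := 'CF([set: {unit F}]%G).

Section FiniteFieldCharacters.

Variable F : finFieldType.

Implicit Types A B chi T : char_type F.

(* chi(0) := 0, also for the trivial character *)
Definition char_ext chi (x : F) : algC :=
  if insub x : option {unit F} is Some u then chi u else 0.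

Definition char_generator T : Prop :=
  T \is a linear_char /\
  (forall chi, chi \is a linear_char -> exists n : nat, chi = T ^+ n).

Definition char_binom A B : algC :=
  char_ext B (-1) / #|F|%:R * \sum_(x : F) char_ext A x * char_ext B^-1 (1 - x).

(* Linear characters are irreducible and irr lists the irreducible characters
   without repetition, so the sum ranges over all characters of F^*. *)
Definition greene_2F1 (A0 A1 B1 : char_type F) (x : F) : algC :=
  #|F|%:R / (#|F|%:R - 1) *
  \sum_(chi <- irr [set: {unit F}]%G | chi \is a linear_char)
     char_binom (A0 * chi) chi * char_binom (A1 * chi) (B1 * chi)
     * char_ext chi x.

End FiniteFieldCharacters.

(* y^2 + a1 x y + a3 y = x^3 + a2 x^2 + a4 x + a6 *)
Record weierstrass (R : Type) : Type := Weierstrass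
  { wa1 : R; wa2 : R; wa3 : R; wa4 : R; wa6 : R }.

Definition map_weierstrass (R S : Type) (h : R -> S) (E : weierstrass R) :=
  Weierstrass (h (wa1 E)) (h (wa2 E)) (h (wa3 E)) (h (wa4 E)) (h (wa6 E)).

Section WeierstrassCurves.

Variables (K : fieldType) (E : weierstrass K).

Definition on_curve (x y : K) : bool :=
  y ^+ 2 + wa1 E * x * y + wa3 E * y
    == x ^+ 3 + wa2 E * x ^+ 2 + wa4 E * x + wa6 E.

(* both partial derivatives of the Weierstrass equation vanish *)
Definition singular_point (x y : K) : bool :=
  [&& on_curve x y,
      wa1 E * y - (3%:R * x ^+ 2 + 2%:R * wa2 E * x + wa4 E) == 0
    & 2%:R * y + wa1 E * x + wa3 E == 0].

End WeierstrassCurves.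

(* Smoothness is geometric: no singular point over any extension of K.  Only
   affine points need testing, since the point at infinity of a Weierstrass
   cubic is always smooth. *)
Definition elliptic_curve (K : fieldType) (E : weierstrass K) : Prop :=
  forall (L : fieldType) (h : {rmorphism K -> L}) (x y : L),
    ~~ singular_point (map_weierstrass h E) x y.

(* The added 1 is the point at infinity. *)
Definition num_points (F : finFieldType) (E : weierstrass F) : nat :=
  #|[set P : F * F | on_curve E P.1 P.2]|.+1.

Definition frob_trace (F : finFieldType) (E : weierstrass F) : int :=
  #|F|%:Z + 1 - (num_points E)%:Z.

Definition E2 (F : finFieldType) (f g : F) : weierstrass F :=
  Weierstrass 0 f 0 g 0.

(* Main.v *)
(* Put phi = T^((q-1)/2), A = T^((q-1)/4) and x = 4g/f^2.  Orthogonality of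
   characters turns the hypergeometric series into 1/q times the sum of
   A(u/v) over the pairs with u v x = (1-u)(1-v); with u = r v, counting the
   roots v of the resulting quadratic gives
     sum_r A(r) (1 + phi((1+r)^2 - 4r(1-x))).
   After r -> -r this is symmetric under r -> 1/r, so that only the squares
   r = s^2 contribute, and w = s + 1/s turns it, up to the sign A(-1), into
     sum_w phi(w+2) phi(w^2-4x).
   The trace of E2 is - sum_t phi(t) phi(t^2+ft+g), and w = t + g/t turns it
   into - sum_w phi(w+f) phi(w^2-4g), which is the previous sum after
   rescaling w by f/2. *)
Require Import Defs.
From mathcomp Require Import all_boot all_order all_algebra all_fingroup.
From mathcomp Require Import all_solvable all_field all_character.
From mathcomp Require Import ring.

Set Implicit Arguments.
Unset Strict Implicit.

Import GRing.Theory Num.Theory.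
Local Open Scope ring_scope.

(** * Square roots and sums of a quadratic character *)

Lemma count_sqrt_sqr (F : finFieldType) (x : F) :
  2%:R != 0 :> F -> x != 0 -> \sum_(y | y ^+ 2 == x ^+ 2) 1 = 1 + 1 :> algC.
Proof.
move=> two_neq0 x0; under eq_bigl => y do rewrite eqf_sqr.
have xNx : - x != x.
  apply: contra x0 => /eqP xNx; rewrite -(mulrI_eq0 x (mulfI two_neq0)).
  by rewrite mulr_natl mulr2n -{1}xNx addNr.
rewrite (bigD1 x) ?eqxx //= (big_pred1 (- x)) // => y /=.
by case: (eqVneq y x) => [->|_] /=; rewrite ?andbT // eq_sym (negPf xNx).
Qed.

Section QuadraticCharacterSums.

Variables (F : finFieldType) (phi : F -> algC).
Hypothesis two_neq0 : 2%:R != 0 :> F.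
Hypothesis phiM : {morph phi : x y / x * y}.
Hypothesis phi_count : forall d, \sum_(y | y ^+ 2 == d) 1 = 1 + phi d.

Lemma quad_char0 : phi 0 = 0.
Proof.
apply: (addrI 1); rewrite -phi_count addr0 (big_pred1 0) // => y.
by rewrite sqrf_eq0.
Qed.

Lemma quad_char_sqr x : x != 0 -> phi (x ^+ 2) = 1.
Proof. by move=> x0; apply: (addrI 1); rewrite -phi_count count_sqrt_sqr. Qed.

Lemma quad_char_mul_sqr x y : x != 0 -> phi (x ^+ 2 * y) = phi y.
Proof. by move=> x0; rewrite phiM quad_char_sqr ?mul1r. Qed.

(** Every [y] is a square root of exactly one [d], so the sum of [1 + phi d] over all [d] is the
    number of elements of [F]. *)
Lemma sum_quad_char : \sum_x phi x = 0.
Proof.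
apply: (addrI (\sum_(x : F) 1)); rewrite -big_split addr0 /=.
under eq_bigr => d _ do rewrite -phi_count.
by rewrite [RHS](partition_big (fun y => y ^+ 2) predT).
Qed.

(** Completing the square: [x |-> 2 a x + b] maps the roots bijectively onto the square roots of the
    discriminant. *)
Lemma count_quadratic_roots a b c : a != 0 ->
  \sum_(x | a * x ^+ 2 + b * x + c == 0) 1 = 1 + phi (b ^+ 2 - 4%:R * a * c).
Proof.
move=> a0; rewrite -phi_count.
have a20 : 2%:R * a != 0 by rewrite mulf_neq0.
rewrite [RHS](reindex (fun x => 2%:R * a * x + b)) /=.
  apply: eq_bigl => x.
  rewrite -(mulrI_eq0 _ (mulfI (mulf_neq0 two_neq0 a20))) -[RHS]subr_eq0.
  congr (_ == _); ring.
exists (fun y => (y - b) / (2%:R * a)) => x _ /=; field; by rewrite a0 two_neq0.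
Qed.

(* The substitution [w = t + g / t] trades [phi t] for [phi (w ^+ 2 - 4 g)]:
   this is the 2-isogeny with kernel generated by the point (0,0). *)
Lemma sum_quad_char_cubic f g : g != 0 ->
  \sum_t phi (t ^+ 3 + f * t ^+ 2 + g * t) =
  \sum_w phi (w + f) * phi (w ^+ 2 - 4%:R * g).
Proof.
move=> g0.
transitivity (\sum_(t | t != 0) phi (t + g / t + f)).
  rewrite (bigD1 0) //= !(expr0n, mulr0, addr0) quad_char0 add0r.
  apply: eq_bigr => t t0; rewrite -[RHS](quad_char_mul_sqr _ t0).
  by congr phi; field.
rewrite (partition_big (fun t => t + g / t) predT) //=.
(* The added 1 contributes a full sum of [phi], which is 0; it makes the second factor the number of
   roots of [t ^+ 2 - w t + g]. *)
transitivity (\sum_w phi (w + f) * (1 + phi (w ^+ 2 - 4%:R * g))); last first.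
  under [LHS]eq_bigr => w _ do rewrite mulrDr mulr1.
  rewrite big_split /=.
  have <- : \sum_w phi w = \sum_w phi (w + f) by apply: reindex_inj (addIr f).
  by rewrite sum_quad_char add0r.
apply: eq_bigr => w _.
under [LHS]eq_bigr => t /andP[_ /eqP ->] do rewrite -[phi _]mulr1.
rewrite -mulr_sumr; congr (_ * _).
transitivity (1 + phi ((- w) ^+ 2 - 4%:R * 1 * g)); last by rewrite sqrrN mulr1.
rewrite -count_quadratic_roots ?oner_eq0 //; apply: eq_bigl => t.
have [->|t0] /= := eqVneq t 0.
  by rewrite expr0n !mulr0 !add0r (negPf g0).
rewrite -[LHS]subr_eq0 -(mulrI_eq0 _ (mulfI t0)); congr (_ == _).
by field.
Qed.

(** A root of [s ^+ 2 - w s + 1] satisfies [s (w + 2) = (s + 1) ^+ 2], so [phi s = phi (w + 2)] when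
    [w != - 2]. There are [1 + phi (w ^+ 2 - 4)] roots, and [w ^+ 2 - 4 = (w + 2) (w - 2)]. *)
Lemma sum_quad_char_recip_roots w : phi (-1) = 1 ->
  \sum_(s | s + s^-1 == w) phi s = phi (w + 2%:R) + phi (w - 2%:R).
Proof.
move=> phiN1.
have phiN x : phi (- x) = phi x by rewrite -mulN1r phiM phiN1 mul1r.
have four0 : 4%:R != 0 :> F by rewrite (natrM _ 2 2) mulf_neq0.
transitivity (\sum_(s | 1 * s ^+ 2 + (- w) * s + 1 == 0) phi s).
  (* Since [0^-1 = 0], the index [s = 0] occurs on the left when [w = 0]; its term is
     [phi 0 = 0]. *)
  rewrite (bigID (pred1 0)) /= addrC [X in _ + X]big1 ?addr0; last first.
    by move=> s /andP[_ /eqP ->]; rewrite quad_char0.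
  apply: eq_bigl => s; have [->|s0] /= := eqVneq s 0.
    by rewrite andbF expr0n !mulr0 !add0r oner_eq0.
  rewrite andbT -[LHS]subr_eq0 -(mulrI_eq0 _ (mulfI s0)); congr (_ == _).
  by field.
(* For [w = - 2] the only root is [s = -1], and both sides equal 1. *)
have [->|w2] := eqVneq w (- 2%:R).
  rewrite (big_pred1 (-1)) => [|s].
    rewrite phiN1 addNr quad_char0 add0r -opprD phiN -natrD.
    by rewrite (natrX _ 2 2) quad_char_sqr.
  by rewrite /= -[RHS]subr_eq0 opprK -[RHS]sqrf_eq0; congr (_ == _); ring.
rewrite (eq_bigr (fun=> phi (w + 2%:R) * 1)) => [|s /eqP rs].
  rewrite -mulr_sumr count_quadratic_roots ?oner_eq0 // mulrDr mulr1.
  rewrite -phiM; congr (_ + _).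
  have w20 : w + 2%:R != 0 by rewrite -[2%:R]opprK subr_eq0.
  rewrite -[RHS](quad_char_mul_sqr (w - 2%:R) w20); congr phi; ring.
have s1 : s + 1 != 0.
  apply: contra w2; rewrite !addr_eq0 => /eqP s1; move: rs; rewrite s1 => e.
  rewrite -addr_eq0 -{}e; apply/eqP; ring.
have s0 : s != 0.
  by apply/eqP => s0; move: rs; rewrite s0 => /eqP;
     rewrite expr0n !mulr0 !add0r oner_eq0.
rewrite mulr1 -[RHS](quad_char_mul_sqr (w + 2%:R) s0).
have -> : s ^+ 2 * (w + 2%:R) = (s + 1) ^+ 2 * s.
  apply/eqP; rewrite -subr_eq0; apply/eqP.
  transitivity (- s * (1 * s ^+ 2 + (- w) * s + 1)); first by ring.
  by rewrite rs mulr0.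
by rewrite quad_char_mul_sqr.
Qed.

End QuadraticCharacterSums.

(** * Sums of a quartic character [A] with quadratic square [phi] *)

Section QuarticCharacterSums.

Variables (F : finFieldType) (A : F -> algC).
Hypothesis two_neq0 : 2%:R != 0 :> F.
Hypothesis AM : {morph A : x y / x * y}.

Let phi x := A x ^+ 2.
Hypothesis phi_count : forall d, \sum_(y | y ^+ 2 == d) 1 = 1 + phi d.

Let phiM : {morph phi : x y / x * y}.
Proof. by move=> x y; rewrite /phi AM exprMn. Qed.

Let phi0 : phi 0 = 0. Proof. exact: quad_char0. Qed.

Let phi_mul_sqr x y : x != 0 -> phi (x ^+ 2 * y) = phi y.
Proof. exact: quad_char_mul_sqr. Qed.

Lemma quartic_char0 : A 0 = 0.
Proof. by apply/eqP; rewrite -sqrf_eq0; apply/eqP/phi0. Qed.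

Lemma quartic_char_expn4 x : x != 0 -> A x ^+ 4 = 1.
Proof.
move=> x0; rewrite -(quad_char_sqr two_neq0 phi_count x0) /phi.
by rewrite [x ^+ 2]expr2 AM; ring.
Qed.

Lemma quartic_char1 : A 1 = 1.
Proof.
have A11 : A 1 * A 1 = A 1 by rewrite -AM mulr1.
by rewrite -[RHS](quartic_char_expn4 (oner_neq0 F)) !exprS expr0 mulr1 !A11.
Qed.

Lemma quartic_charV x : A x^-1 = A x ^+ 3.
Proof.
have [->|x0] := eqVneq x 0;
  first by rewrite invr0 quartic_char0 expr0n.
rewrite -[LHS]mulr1 -(quartic_char_expn4 x0) exprS mulrA -AM mulVf //.
by rewrite quartic_char1 mul1r.
Qed.

Lemma quartic_charN1_sqr : A (-1) ^+ 2 = 1.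
Proof. by rewrite expr2 -AM mulrNN mulr1 quartic_char1. Qed.

(* Both sides count each square [r] with the weights of its square roots,
   since [A r^-1 + A r = A r * (1 + phi r)] and [phi s = A (s ^+ 2)]. *)
Lemma sum_quartic_char_recip (k : F -> algC) :
  (forall r, r != 0 -> k r^-1 = k r) ->
  \sum_s phi s * k (s ^+ 2) = 2%:R * \sum_r A r * k r.
Proof.
move=> kV.
transitivity (\sum_r A r * k r * (1 + phi r)).
  rewrite (partition_big (fun s => s ^+ 2) predT) //=; apply: eq_bigr => r _.
  rewrite -phi_count mulr_sumr; apply: eq_bigr => s /eqP <-.
  by rewrite mulr1 [s ^+ 2]expr2 AM.
under eq_bigr => r _ do rewrite mulrDr mulr1.
rewrite big_split /= [RHS]mulr_natl mulr2n; congr (_ + _).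
rewrite [RHS](reindex_inj invr_inj) /=; apply: eq_bigr => r _.
have [->|r0] := eqVneq r 0;
  first by rewrite invr0 phi0 quartic_char0 !mul0r.
by rewrite kV // quartic_charV /phi; ring.
Qed.

Lemma sum_quartic_char_quadratic x :
  A (-1) * \sum_r A r * (1 + phi ((1 + r) ^+ 2 - 4%:R * r * (1 - x))) =
  \sum_w phi (w + 2%:R) * phi (w ^+ 2 - 4%:R * x).
Proof.
have phiN1 : phi (-1) = 1 by exact: quartic_charN1_sqr.
have phiN y : phi (- y) = phi y by rewrite -mulN1r phiM phiN1 mul1r.
pose k r := 1 + phi ((1 + r) ^+ 2 - 4%:R * r * x).
have -> : A (-1) * \sum_r A r * (1 + phi ((1 + r) ^+ 2 - 4%:R * r * (1 - x)))
    = \sum_r A r * k r.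
  rewrite (reindex_inj oppr_inj) mulr_sumr; apply: eq_bigr => r _.
  rewrite -[- r]mulN1r AM !mulrA -expr2 quartic_charN1_sqr mul1r.
  by congr (_ * (1 + phi _)); ring.
(* Both sides are doubled: on the left to pass to the squares [r = s ^+ 2], on the right because
   [w |-> - w] exchanges the terms with [w + 2] and [w - 2]. *)
apply: (mulfI (_ : 2%:R != 0 :> algC)); first by rewrite pnatr_eq0.
rewrite -sum_quartic_char_recip => [|r r0]; last first.
  rewrite /k -(phi_mul_sqr _ r0); congr (1 + phi _); field; exact: r0.
under eq_bigr => s _ do rewrite mulrDr mulr1.
rewrite big_split /= sum_quad_char // add0r.
transitivity (\sum_s phi s * phi ((s + s^-1) ^+ 2 - 4%:R * x)).
  apply: eq_bigr => s _; have [->|s0] := eqVneq s 0;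
    first by rewrite phi0 !mul0r.
  rewrite -[X in _ = _ * X](phi_mul_sqr _ s0); congr (_ * phi _); field; exact: s0.
rewrite (partition_big (fun s => s + s^-1) predT) //=.
transitivity (\sum_w (phi (w + 2%:R) + phi (w - 2%:R)) *
                phi (w ^+ 2 - 4%:R * x)).
  apply: eq_bigr => w _; rewrite -sum_quad_char_recip_roots // mulr_suml.
  by apply: eq_bigr => s /eqP ->.
under [LHS]eq_bigr => w _ do rewrite mulrDl.
rewrite big_split /= [RHS]mulr_natl mulr2n; congr (_ + _).
rewrite (reindex_inj oppr_inj); apply: eq_bigr => w _.
by rewrite sqrrN -opprD phiN.
Qed.

Lemma sum_quartic_char_cubic f g : f != 0 -> g != 0 ->
  \sum_t phi (t ^+ 3 + f * t ^+ 2 + g * t) =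
  phi (2%:R * f) * A (-1) *
  \sum_r A r * (1 + phi ((1 + r) ^+ 2 - 4%:R * r * (1 - 4%:R * g / f ^+ 2))).
Proof.
move=> f0 g0; rewrite -mulrA sum_quartic_char_quadratic sum_quad_char_cubic //.
have f20 : f / 2%:R != 0 by rewrite mulf_neq0 ?invr_neq0.
(* After scaling [w] by [f / 2], the factor [phi (f / 2)] equals [phi (2 f)], as the arguments
   differ by the square 4. *)
rewrite (reindex_inj (mulfI f20)) mulr_sumr; apply: eq_bigr => w _.
rewrite mulrA -[X in _ = X * _]phiM; congr (_ * _).
  have half0 : 2%:R^-1 != 0 :> F by rewrite invr_neq0.
  rewrite -[RHS](phi_mul_sqr _ half0).
  by congr phi; field.
by rewrite -[RHS](phi_mul_sqr _ f20); congr phi; field; rewrite f0 two_neq0.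
Qed.

(** Put [u = r v] with [v != 0]: the weight becomes [A r * A v ^+ 4 = A r], and the condition
    becomes [r (1 - x) v ^+ 2 - (1 + r) v + 1 = 0], which is quadratic in [v] because [x != 1]. *)
Lemma sum_quartic_char_pairs x : x != 0 -> x != 1 ->
  \sum_u \sum_v A u * A v ^+ 3 * (u * v * x / ((1 - u) * (1 - v)) == 1)%:R =
  \sum_r A r * (1 + phi ((1 + r) ^+ 2 - 4%:R * r * (1 - x))).
Proof.
move=> x0 x1; rewrite exchange_big (bigD1 0) //= big1 ?add0r => [|u _]; last first.
  by rewrite quartic_char0 expr0n mulr0 mul0r.
transitivity (\sum_(v | v != 0) \sum_r A r *
    (r * v * v * x / ((1 - r * v) * (1 - v)) == 1)%:R).
  apply: eq_bigr => v v0; rewrite (reindex_inj (mulIf v0)).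
  apply: eq_bigr => r _; congr (_ * _).
  by rewrite AM -mulrA -exprS quartic_char_expn4 // mulr1.
rewrite exchange_big /=; apply: eq_bigr => r _; rewrite -mulr_sumr.
have [->|r0] := eqVneq r 0;
  first by rewrite quartic_char0 !mul0r.
congr (_ * _).
have a0 : r * (1 - x) != 0 by rewrite mulf_neq0 // subr_eq0 eq_sym.
transitivity (1 + phi ((- (1 + r)) ^+ 2 - 4%:R * (r * (1 - x)) * 1)); last first.
  by congr (1 + phi _); ring.
rewrite -count_quadratic_roots // [LHS]big_mkcond [RHS]big_mkcond.
apply: eq_bigr => v _; have [->|v0] /= := eqVneq v 0.
  by rewrite expr0n !mulr0 !add0r oner_eq0.
set D := (1 - r * v) * (1 - v).
have -> : r * (1 - x) * v ^+ 2 + - (1 + r) * v + 1 = D - r * v * v * x.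
  by rewrite /D; ring.
(* When [D = 0] the quotient is 0 by convention, so the indicator vanishes; the quadratic is then
   [- r v ^+ 2 x], nonzero since [x != 0]. *)
have [D0|D0] := eqVneq D 0.
  rewrite D0 invr0 mulr0 eq_sym oner_eq0 sub0r oppr_eq0 !mulf_eq0.
  by rewrite (negPf r0) (negPf v0) (negPf x0).
rewrite subr_eq0 -(inj_eq (mulIf D0)) divfK // mul1r eq_sym.
by case: eqP.
Qed.

End QuarticCharacterSums.

(** * Characters of the unit group and Greene's series *)

Section CharacterValues.

Variable F : finFieldType.
Implicit Types (chi A B T : char_type F) (x y d : F).

Let G := [set: {unit F}]%G.

Lemma nonzero_unit x : x != 0 -> exists u : {unit F}, x = val u.
Proof. by move=> x0; exists (finField_unit x0). Qed.

Lemma abelian_unit_group : abelian G.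
Proof. exact/cyclic_abelian/field_unit_group_cyclic. Qed.

Lemma char_ext_val chi (u : {unit F}) : char_ext chi (val u) = chi u.
Proof. by rewrite /char_ext valK. Qed.

Lemma char_ext0 chi : char_ext chi 0 = 0.
Proof. by rewrite /char_ext insubF // unitr0. Qed.

Lemma char_extM chi :
  chi \is a linear_char -> {morph char_ext chi : x y / x * y}.
Proof.
move=> lin x y.
have [->|/nonzero_unit[u ->]] := eqVneq x 0;
  first by rewrite mul0r char_ext0 mul0r.
have [->|/nonzero_unit[v ->]] := eqVneq y 0;
  first by rewrite mulr0 char_ext0 mulr0.
by rewrite -FinRing.val_unitM !char_ext_val lin_charM ?inE.
Qed.

Lemma char_ext1 chi : chi \is a linear_char -> char_ext chi 1 = 1.
Proof.
by move=> lin; rewrite -(FinRing.val_unit1 F) char_ext_val lin_char1.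
Qed.

Lemma char_extV chi x :
  chi \is a linear_char -> char_ext chi x^-1 = (char_ext chi x)^-1.
Proof.
move=> lin; have [->|x0] := eqVneq x 0;
  first by rewrite invr0 char_ext0 invr0.
have e : char_ext chi x^-1 * char_ext chi x = 1.
  by rewrite -char_extM // mulVf // char_ext1.
have x'0 : char_ext chi x != 0.
  by apply/eqP => x'0; move/eqP: e; rewrite x'0 mulr0 eq_sym oner_eq0.
by apply: (mulIf x'0); rewrite e mulVf.
Qed.

Lemma char_ext_mul chi A x :
  char_ext (chi * A) x = char_ext chi x * char_ext A x.
Proof.
have [->|/nonzero_unit[u ->]] := eqVneq x 0;
  first by rewrite !char_ext0 mul0r.
by rewrite !char_ext_val cfunE.
Qed.

Lemma char_ext_expn chi n x :
  (0 < n)%N -> char_ext (chi ^+ n) x = char_ext chi x ^+ n.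
Proof.
move=> n0; have [->|/nonzero_unit[u ->]] := eqVneq x 0.
  by rewrite !char_ext0 expr0n eqn0Ngt n0.
by rewrite !char_ext_val exp_cfunE ?inE.
Qed.

Lemma char_ext_inv chi x :
  chi \is a linear_char -> char_ext chi^-1 x = (char_ext chi x)^-1.
Proof.
move=> lin; have [->|/nonzero_unit[u ->]] := eqVneq x 0.
  by rewrite !char_ext0 invr0.
rewrite !char_ext_val invr_lin_char // cfunE.
by rewrite -[RHS]lin_charV ?inE // lin_charV_conj ?inE.
Qed.

(** Column orthogonality, read off the regular character: the unit group is abelian, so each
    irreducible character occurs in it once. *)
Lemma sum_char_ext x :
  \sum_(chi <- irr G | chi \is a linear_char) char_ext chi x =
  (#|F|%:R - 1) * (x == 1)%:R.
Proof.
have linG := char_abelianP _ abelian_unit_group.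
rewrite big_tuple; under eq_bigl => i do rewrite linG.
have [->|/nonzero_unit[u ->]] := eqVneq x 0.
  rewrite eq_sym oner_eq0 mulr0 big1 // => i _; exact: char_ext0.
have := congr1 (fun phi : 'CF(G) => phi u) (cfReg_sum G).
rewrite cfRegE sum_cfunE => e.
transitivity (\sum_(i < Nirr G) ('chi_i 1%g *: 'chi_i) u).
  by apply: eq_bigr => i _; rewrite cfunE lin_char1 ?linG // mul1r char_ext_val.
rewrite -{}e -(FinRing.val_unit1 F) (inj_eq val_inj) card_finField_unit.
rewrite -mulr_natr; congr (_ * _).
by rewrite -subn1 natrB // (ltnW (finNzRing_gt1 F)).
Qed.

(** The two signs [chi (-1)] cancel and all values of [chi] merge into one, with [0^-1 = 0] covering
    [u = 1] and [v = 1]. Summing over [chi] first gives [q - 1] times an indicator. *)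
Lemma greene_2F1_double_sum A B x :
  A \is a linear_char -> B \is a linear_char ->
  greene_2F1 A B 1 x =
  #|F|%:R^-1 * \sum_u \sum_v char_ext A u * char_ext B v *
                  (u * v * x / ((1 - u) * (1 - v)) == 1)%:R.
Proof.
move=> linA linB.
have q0 : #|F|%:R != 0 :> algC.
  by rewrite pnatr_eq0 -lt0n (ltnW (finNzRing_gt1 F)).
have q10 : #|F|%:R - 1 != 0 :> algC.
  by rewrite subr_eq0 pnatr_eq1 neq_ltn finNzRing_gt1 orbT.
rewrite /greene_2F1.
transitivity (#|F|%:R / (#|F|%:R - 1) *
  \sum_(chi <- irr G | chi \is a linear_char) #|F|%:R^-1 ^+ 2 *
   \sum_u \sum_v char_ext A u * char_ext B v *
     char_ext chi (u * v * x / ((1 - u) * (1 - v)))).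
  congr (_ * _); apply: eq_bigr => chi lin; rewrite /char_binom mul1r.
  have sgn : char_ext chi (-1) ^+ 2 = 1.
    by rewrite expr2 -char_extM // mulrNN mulr1 char_ext1.
  set a := \sum_x char_ext (A * chi) x * _.
  set b := \sum_x char_ext (B * chi) x * _.
  transitivity (char_ext chi (-1) ^+ 2 * #|F|%:R^-1 ^+ 2 *
    (a * b * char_ext chi x)).
    by ring.
  rewrite sgn mul1r; congr (_ * _).
  rewrite /a /b -mulrA mulr_suml; apply: eq_bigr => u _.
  rewrite mulr_suml mulr_sumr; apply: eq_bigr => v _.
  rewrite !char_ext_mul !char_ext_inv // !char_extM // char_extV // char_extM //.
  by rewrite invfM; ring.
rewrite -mulr_sumr exchange_big /=.
under eq_bigr => u _.
  rewrite exchange_big /=.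
  under eq_bigr => v _ do rewrite -mulr_sumr sum_char_ext mulrCA.
  rewrite -mulr_sumr; over.
rewrite -mulr_sumr !mulrA; congr (_ * _).
by field; rewrite q0 q10.
Qed.

(** Otherwise [T ^+ h] is trivial, and at most [h] powers of [T] would exhaust the [q - 1]
    characters. *)
Lemma char_generator_unit_neq1 T h (w : {unit F}) :
  char_generator T -> (0 < h < #|F|.-1)%N -> (forall u, u \in <[w]>%g) ->
  T w ^+ h != 1.
Proof.
move=> [linT genT] /andP[h0 hq] Gw; apply/eqP => Tw1.
have Th1 : T ^+ h = 1.
  apply/cfun_inP => u _; have /cycleP[n ->] := Gw u.
  by rewrite exp_cfunE ?inE // lin_charX ?inE // exprAC Tw1 expr1n cfun1E inE.
suff : (size (irr G) <= size [seq T ^+ i | i <- iota 0 h])%N.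
  rewrite size_map size_iota size_tuple NirrE.
  move: abelian_unit_group; rewrite card_classes_abelian => /eqP ->.
  by rewrite card_finField_unit leqNgt hq.
apply: uniq_leq_size => [|chi irr_chi]; first exact/free_uniq/irr_free.
have [n ->] : exists n, chi = T ^+ n.
  apply: genT; case/irrP: irr_chi => i ->;
    exact: char_abelianP abelian_unit_group i.
apply/mapP; exists (n %% h)%N; first by rewrite mem_iota ltn_mod.
by rewrite {1}(divn_eq n h) exprD mulnC exprM Th1 expr1n mul1r.
Qed.

(** For a generator [w] of the units, [T w ^+ h] is a square root of 1 other than 1, hence -1. So
    [T ^+ h] sends [w ^+ k] to the sign of the parity of [k], which decides whether [w ^+ k] is a
    square. *)
Lemma count_sqrt_char_generator T h d :
  2%:R != 0 :> F -> char_generator T -> #|F|.-1 = h.*2 ->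
  \sum_(y | y ^+ 2 == d) 1 = 1 + char_ext (T ^+ h) d.
Proof.
move=> two_neq0 genT qh; have [linT _] := genT.
have h0 : (0 < h)%N by rewrite -double_gt0 -qh -subn1 subn_gt0 finNzRing_gt1.
have [->|/nonzero_unit[u ->]] := eqVneq d 0.
  by rewrite char_ext0 addr0 (big_pred1 0) // => y; rewrite sqrf_eq0.
have [w Gw] : exists w : {unit F}, forall u, u \in <[w]>%g.
  by have /cyclicP[w Gw] := field_unit_group_cyclic G; exists w => v;
     rewrite -Gw inE.
have Tw1 : T w ^+ h.*2 = 1.
  by rewrite -qh -card_finField_unit -lin_charX ?inE //
     expg_cardG ?inE ?lin_char1.
have TwN1 : T w ^+ h = -1.
  have : (T w ^+ h) ^+ 2 == 1 by rewrite -exprM muln2 Tw1.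
  rewrite sqrf_eq1 (negPf (char_generator_unit_neq1 genT _ _)) ?h0 ?qh.
  - by move/eqP.
  - by rewrite -addnn -{1}[h]addn0 ltn_add2l.
  exact: Gw.
have /cycleP[k ->] := Gw u.
rewrite char_ext_val exp_cfunE ?inE // lin_charX ?inE // exprAC TwN1.
rewrite -signr_odd; have := odd_double_half k; case: (odd k) => /= ek.
  rewrite expr1 subrr big_pred0 // => y; apply/negP => /eqP yk.
  have /nonzero_unit[v yv] : y != 0.
    by rewrite -(sqrf_eq0 y) yk -unitfE; apply: valP.
  have /cycleP[j vj] := Gw v.
  have {yv vj}yk : (w ^+ (j.*2))%g = (w ^+ k)%g.
    apply: val_inj; transitivity (y ^+ 2); last exact: yk.
    by rewrite yv vj -[RHS]FinRing.val_unitX -expgM muln2.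
  have /(congr1 (fun v => T v ^+ h)) := yk.
  rewrite !lin_charX ?inE // ![(_ ^+ _) ^+ h]exprAC TwN1 -signr_odd odd_double.
  rewrite -ek exprD exprS expr0 -signr_odd odd_double mulr1 expr0 mulr1.
  by move/eqP; rewrite eq_sym -subr_eq0 -opprD oppr_eq0 -mulr2n pnatr_eq0.
rewrite expr0 -ek add0n -muln2 expgM FinRing.val_unitX.
by apply: count_sqrt_sqr; rewrite // -unitfE; apply: valP.
Qed.

End CharacterValues.

(** * The curve: smoothness and point count *)

Lemma elliptic_E2_neq0 (F : finFieldType) (f g : F) :
  elliptic_curve (E2 f g) -> g != 0.
Proof.
move=> /(_ F idfun 0 0); apply: contra => /eqP ->.
rewrite /singular_point /on_curve /= !(expr0n, mulr0, mul0r, addr0) /=.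
by rewrite subrr eqxx.
Qed.

(** If [f ^+ 2 = 4 g], the cubic is [x (x + f / 2) ^+ 2], and its double root gives a singular
    point. *)
Lemma elliptic_E2_disc_neq0 (F : finFieldType) (f g : F) : 2%:R != 0 :> F ->
  elliptic_curve (E2 f g) -> f ^+ 2 != 4%:R * g.
Proof.
move=> two_neq0 /(_ F idfun (- f / 2%:R) 0); apply: contra => /eqP e.
have -> : g = f ^+ 2 / 4%:R.
  by rewrite e; field; rewrite (natrM _ 2 2) mulf_neq0.
have four_neq0 : 4%:R != 0 :> F by rewrite (natrM _ 2 2) mulf_neq0.
rewrite /singular_point /on_curve /=.
by apply/and3P; split; apply/eqP; field; rewrite ?two_neq0 ?four_neq0.
Qed.

(** Each abscissa [t] carries [1 + phi] affine points, with [phi] taken at the cubic; the point at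
    infinity cancels the 1 in the trace. *)
Lemma frob_trace_quad_char (F : finFieldType) (phi : F -> algC) (f g : F) :
  (forall d, \sum_(y | y ^+ 2 == d) 1 = 1 + phi d) ->
  (frob_trace (E2 f g))%:~R = - \sum_t phi (t ^+ 3 + f * t ^+ 2 + g * t).
Proof.
move=> phi_count; rewrite /frob_trace /num_points.
set N := #|_|.
have -> : (#|F|%:Z + 1 - N.+1%:Z)%:~R = #|F|%:R - N%:R :> algC.
  by rewrite -[N.+1]addn1 PoszD opprD addrACA subrr addr0 rmorphB.
have -> : N%:R = \sum_(t : F)
      \sum_(y : F | y ^+ 2 == t ^+ 3 + f * t ^+ 2 + g * t) 1 :> algC.
  rewrite pair_big_dep /= sumr_const; congr _%:R; apply: eq_card => P.
  by rewrite [LHS]inE /on_curve /= !mul0r !addr0.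
under eq_bigr => t _ do rewrite phi_count.
by rewrite big_split /= sumr_const opprD addrA subrr add0r.
Qed.

Theorem theorem3p2 (p e q : nat) (hp : prime p) (hq : q = (p ^ e)%N)
    (hq4 : q = 1 %[mod 4]) (F : finFieldType) (hF : #|F| = q)
    (f g : F) (hf : f != 0) (hE : elliptic_curve (E2 f g))
    (T : char_type F) (hT : char_generator T) :
  (frob_trace (E2 f g))%:~R =
    - q%:R * char_ext (T ^+ ((q - 1) %/ 2)) (2%:R * f)
           * char_ext (T ^+ ((q - 1) %/ 4)) (-1)
           * greene_2F1 (T ^+ ((q - 1) %/ 4)) (T ^+ (3 * (q - 1) %/ 4)) 1
               (4%:R * g / f ^+ 2).
Proof.
have q1 : (1 < q)%N by rewrite -hF finNzRing_gt1.
have [m qm] : exists m, q = (4 * m).+1.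
  exists (q %/ 4)%N; rewrite {1}(divn_eq q 4) hq4 mulnC addn1 //.
have m0 : (0 < m)%N by move: q1; rewrite qm; case: (m).
(* In [F] the number [q = 4 m + 1] is 0, whereas [2 = 0] would make it 1. *)
have two_neq0 : 2%:R != 0 :> F.
  have pF : p \in [pchar F] by apply: card_finPcharP hp; rewrite hF hq.
  have : q%:R = 0 :> F.
    case: e hq => [|e] hq'; first by rewrite hq' in q1.
    by rewrite hq' natrX (pcharf0 pF) expr0n.
  apply: contra_eq_neq => /eqP two0; rewrite qm -addn1 natrD natrM (natrM _ 2 2).
  by rewrite (eqP two0) !mul0r add0r oner_neq0.
have -> : ((q - 1) %/ 2 = m.*2)%N.
  by rewrite qm subn1 /= -[4%N]/(2 * 2)%N -mulnA mulKn // mul2n.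
have -> : ((q - 1) %/ 4 = m)%N by rewrite qm subn1 /= mulKn.
have -> : (3 * (q - 1) %/ 4 = m * 3)%N.
  by rewrite qm subn1 /= mulnCA mulKn // mulnC.
have [linT _] := hT; pose A := char_ext (T ^+ m).
have linTm : T ^+ m \is a linear_char by exact: rpredX.
have AM : {morph A : x y / x * y} by exact: char_extM.
have phiE x : char_ext (T ^+ m.*2) x = A x ^+ 2.
  by rewrite -muln2 exprM char_ext_expn.
have phi_count d : \sum_(y | y ^+ 2 == d) 1 = 1 + A d ^+ 2.
  rewrite -phiE; apply: count_sqrt_char_generator => //.
  by rewrite hF qm /= -!muln2 -mulnA mulnC.
have g0 := elliptic_E2_neq0 hE.
have four_neq0 : 4%:R != 0 :> F by rewrite (natrM _ 2 2) mulf_neq0.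
(* Smoothness of the curve is what keeps the argument of the series away from 0 and 1. *)
have x0 : 4%:R * g / f ^+ 2 != 0 by rewrite !mulf_neq0 ?invr_neq0 ?expf_neq0.
have x1 : 4%:R * g / f ^+ 2 != 1.
  rewrite -subr_eq0 -(mulIr_eq0 _ (mulIf (expf_neq0 2 hf))) mulrBl
     divfK ?expf_neq0 //.
  by rewrite mul1r subr_eq0 eq_sym elliptic_E2_disc_neq0.
have q0 : #|F|%:R != 0 :> algC by rewrite pnatr_eq0 hF qm.
rewrite (frob_trace_quad_char _ _ phi_count) sum_quartic_char_cubic //.
rewrite -sum_quartic_char_pairs // greene_2F1_double_sum // ?rpredX //.
rewrite -phiE -/(A (-1)) -hF !mulNr; congr (- _).
set S := \sum_u _; set S' := \sum_u _.
have -> : S' = S.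
  apply: eq_bigr => u _; apply: eq_bigr => v _.
  by rewrite exprM [char_ext (_ ^+ 3) v]char_ext_expn.
by field.
Qed.
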